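(* Suppose a Banach space $X$ has a boundedly complete basis $(e_i)$ and $X^*=[e_i^*]\oplus Z^*$ for some finite dimensional space $Z^*$. Then $c_0$ does not coarsely embed into $X$.
   Context: $(e_i^* )$ are the biorthogonal functionals of $(e_i)$ and $[e_i^*]$ is their closed linear span in $X^*$; $Z^*$ is a subspace of $X^*$. A basis $(e_i)$ is boundedly complete if $\sum_i a_ie_i$ converges whenever $\sup_n\|\sum_{i\le n}a_ie_i\|<\infty$. A map $\phi:X_1\to X_2$ between metric spaces is a coarse embedding if there are nondecreasing functions $\rho,\omega:[0,\infty)\to[0,\infty)$ with $\lim_{t\to\infty}\rho(t)=\infty$ and $\rho(d(x,y))\le d(\phi(x),\phi(y))\le\omega(d(x,y))$ for all $x,y\in X_1$. *)

(* Defs.v *)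
From HB Require Import structures.
From mathcomp Require Import all_boot all_order all_algebra.
From mathcomp Require Import all_classical all_reals all_analysis.
Set Implicit Arguments.
Unset Strict Implicit.
Unset Printing Implicit Defensive.
Import Order.TTheory GRing.Theory Num.Theory.
Import numFieldNormedType.Exports.
Local Open Scope classical_set_scope.
Local Open Scope ring_scope.

Section supnorm.
Variables (R : realType) (T : Type) (A : set T).
Implicit Types f g : T -> R.

(* Only meaningful when [f] is bounded on [A] and [A] is nonempty. *)
Definition sup_abs f : R := sup [set `|f t| | t in A].

Let has_sup_abs f : A !=set0 -> has_ubound [set `|f t| | t in A] ->
  has_sup [set `|f t| | t in A].
Proof. by move=> [t At] ub; split => //; exists `|f t|, t. Qed.

Lemma sup_abs_ge f t : has_ubound [set `|f t| | t in A] -> A t ->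
  `|f t| <= sup_abs f.
Proof. by move=> ub At; apply: ub_le_sup => //; exists t. Qed.

Lemma sup_abs_le f M : A !=set0 -> (forall t, A t -> `|f t| <= M) ->
  sup_abs f <= M.
Proof.
move=> [t At] fM; apply: ge_sup; first by exists `|f t|, t.
by move=> _ [s As <-]; exact: fM.
Qed.

Lemma sup_absD f g : A !=set0 ->
  has_ubound [set `|f t| | t in A] -> has_ubound [set `|g t| | t in A] ->
  sup_abs (fun t => f t + g t) <= sup_abs f + sup_abs g.
Proof.
move=> A0 uf ug; apply: sup_abs_le => // t At.
by rewrite (le_trans (ler_normD _ _))// lerD// sup_abs_ge.
Qed.

Lemma sup_absZ (l : R) f : A !=set0 -> has_ubound [set `|f t| | t in A] ->
  sup_abs (fun t => l * f t) = `|l| * sup_abs f.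
Proof.
move=> A0 uf; apply/eqP; rewrite eq_le; apply/andP; split.
  by apply: sup_abs_le => // t At; rewrite normrM ler_wpM2l// sup_abs_ge.
have ulf : has_ubound [set `|l * f t| | t in A].
  case: uf => M uM; exists (`|l| * M) => _ [t At <-].
  by rewrite normrM ler_wpM2l// uM//; exists t.
have [->|l0] := eqVneq l 0.
  rewrite normr0 mul0r; case: A0 => t At; apply: (le_trans (normr_ge0 (0 * f t))).
  by apply: (@sup_abs_ge (fun t => 0 * f t)) => //; exists 0 => _ [s _ <-];
    rewrite mul0r normr0.
rewrite mulrC -ler_pdivlMr ?normr_gt0//; apply: sup_abs_le => // t At.
rewrite ler_pdivlMr ?normr_gt0// mulrC -normrM.
exact: (@sup_abs_ge (fun t => l * f t)).
Qed.

End supnorm.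

(** [c_0]: real null sequences with the norm [sup_n `|u n|]. *)
Section c0.
Variable R : realType.

Definition null_seq : {pred nat -> R} := fun u => `[< u @ \oo --> (0 : R) >].

Record c0 := C0 { c0_val :> nat -> R; _ : c0_val \in null_seq }.

HB.instance Definition _ := [isSub for c0_val].
HB.instance Definition _ := gen_eqMixin c0.
HB.instance Definition _ := gen_choiceMixin c0.

Lemma c0_cvg (u : c0) : (u : nat -> R) @ \oo --> (0 : R).
Proof. by have /asboolP := valP u. Qed.

Fact null_seq_submod : submod_closed null_seq.
Proof.
split=> [|a u v /asboolP cu /asboolP cv]; apply/asboolP.
  exact: (@cvg_cst R).
suff: (fun n => a * u n + v n) @ \oo --> a * 0 + 0 by rewrite mulr0 addr0.
by apply: cvgD => //; apply: cvgMr.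
Qed.

HB.instance Definition _ :=
  GRing.isSubmodClosed.Build _ _ null_seq null_seq_submod.
HB.instance Definition _ := [SubChoice_isSubLmodule of c0 by <:].

Lemma c0_ubound (u : c0) : has_ubound [set `|u n| | n in [set: nat]].
Proof.
have /cvg_seq_bounded/pinfty_ex_gt0[M _ uM] := cvgP _ (c0_cvg u).
by exists M => _ [n _ <-]; exact: uM.
Qed.

Definition c0_norm (u : c0) : R := sup_abs [set: nat] u.

Let c0_normD u v : c0_norm (u + v) <= c0_norm u + c0_norm v.
Proof.
by apply: (@sup_absD R nat setT u v); [exists 0%N|exact: c0_ubound..].
Qed.

Let c0_normZ (l : R) u : c0_norm (l *: u) = `|l| * c0_norm u.
Proof.
by apply: (@sup_absZ R nat setT l u); [exists 0%N|exact: c0_ubound].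
Qed.

Let c0_norm_eq0 u : c0_norm u = 0 -> u = 0.
Proof.
move=> u0; apply/val_inj/funext => n; apply/eqP.
by rewrite -normr_le0 -u0; apply: (@sup_abs_ge R nat setT u n) => //;
  exact: c0_ubound.
Qed.

HB.instance Definition _ :=
  Lmodule_isNormed.Build R c0 c0_normD c0_normZ c0_norm_eq0.

Lemma c0_normE (u : c0) : `|u| = sup [set `|u n| | n in [set: nat]].
Proof. by []. Qed.

End c0.

(** The topological dual of [X]: continuous linear functionals with the
    operator norm [sup_(`|x| <= 1) `|f x|]. *)
Section dual.
Variables (R : realType) (X : normedModType R).

Definition clinear : {pred X -> R} :=
  fun f => `[< linear (f : X -> R^o) /\ continuous (f : X -> R^o) >].

Record dual_space := Dual { dual_val :> X -> R; _ : dual_val \in clinear }.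

HB.instance Definition _ := [isSub for dual_val].
HB.instance Definition _ := gen_eqMixin dual_space.
HB.instance Definition _ := gen_choiceMixin dual_space.

Lemma dual_linear (f : dual_space) : linear (f : X -> R^o).
Proof. by have /asboolP[] := valP f. Qed.

Lemma dual_continuous (f : dual_space) : continuous (f : X -> R^o).
Proof. by have /asboolP[] := valP f. Qed.

Fact clinear_submod : submod_closed clinear.
Proof.
split=> [|a f g /asboolP[lf cf] /asboolP[lg cg]]; apply/asboolP; split.
- by move=> a x y; rewrite /= scaler0 addr0.
- by move=> x; exact: cvg_cst.
- move=> b x y; have := lf b x y; have := lg b x y.
  rewrite -!/(_ *: _) /= !fctE => -> ->.
  by rewrite !scalerDr !scalerA (mulrC a) addrACA.
- by move=> x; apply: cvgD; [apply: cvgMr; exact: cf|exact: cg].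
Qed.

HB.instance Definition _ :=
  GRing.isSubmodClosed.Build _ _ clinear clinear_submod.
HB.instance Definition _ := [SubChoice_isSubLmodule of dual_space by <:].

Definition unit_ball : set X := [set x | `|x| <= 1].

Let unit_ball0 : unit_ball !=set0.
Proof. by exists 0; rewrite /unit_ball/= normr0. Qed.

HB.instance Definition _ (f : dual_space) :=
  GRing.isLinear.Build R X R^o _ (f : X -> R^o) (dual_linear f).

Lemma dual_ubound (f : dual_space) : has_ubound [set `|f x| | x in unit_ball].
Proof.
have /linear_bounded_continuous/bounded_funP/(_ 1)[M fM] := @dual_continuous f.
by exists M => _ [x x1 <-]; exact: fM.
Qed.

Definition dual_norm (f : dual_space) : R := sup_abs unit_ball f.

Let dual_normD f g : dual_norm (f + g) <= dual_norm f + dual_norm g.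
Proof. by apply: (@sup_absD R X unit_ball f g) => //; exact: dual_ubound. Qed.

Let dual_normZ (l : R) f : dual_norm (l *: f) = `|l| * dual_norm f.
Proof. by apply: (@sup_absZ R X unit_ball l f) => //; exact: dual_ubound. Qed.

Let dual_norm_eq0 f : dual_norm f = 0 -> f = 0.
Proof.
move=> f0; apply/val_inj/funext => x /=; apply/eqP.
have [->|x0] := eqVneq x 0; first by rewrite linear0.
have : `|f (`|x|^-1 *: x)| <= 0.
  rewrite -f0; apply: (@sup_abs_ge R X unit_ball f); first exact: dual_ubound.
  by rewrite /unit_ball/= normrZ normfV normr_id mulVf ?normr_eq0.
rewrite normr_le0 linearZ/= scaler_eq0 invr_eq0 normr_eq0.
by rewrite (negbTE x0).
Qed.

HB.instance Definition _ :=
  Lmodule_isNormed.Build R dual_space dual_normD dual_normZ dual_norm_eq0.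

Lemma dual_normE (f : dual_space) :
  `|f| = sup [set `|f x| | x in [set x | `|x| <= 1]].
Proof. by []. Qed.

End dual.

Section subspaces.
Variables (R : realType) (V : normedModType R).
Implicit Types A B : set V.

Definition lin_span A : set V :=
  [set v | exists n (a : 'I_n -> R) (w : 'I_n -> V),
     (forall i, A (w i)) /\ v = \sum_(i < n) a i *: w i].

Definition closed_span A : set V := closure (lin_span A).

Definition fin_dim_subspace A : Prop :=
  exists2 B, finite_set B & A = lin_span B.

(* Algebraic direct sum; when [A] and [B] are closed and [V] is complete it is
   also topological, by the open mapping theorem. *)
Definition direct_sum A B : Prop :=
  [set x + y | x in A & y in B] = [set: V] /\ A `&` B = [set 0].

End subspaces.

Section bases.
Variables (R : realType) (X : normedModType R).
Implicit Types e : nat -> X.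

Definition schauder_basis e : Prop :=
  forall x : X, exists! a : nat -> R, series (fun i => a i *: e i) @ \oo --> x.

Definition boundedly_complete e : Prop := forall a : nat -> R,
  bounded_fun (series (fun i => a i *: e i)) ->
  cvgn (series (fun i => a i *: e i)).

(* For a Schauder basis [e], whose span is dense, this determines [f]: [f i] is
   the i-th coordinate functional. *)
Definition biorthogonal e (f : nat -> dual_space X) : Prop :=
  forall i j, f i (e j) = (i == j)%:R.

End bases.

(** [V] seen as a metric space with distance [`|x - y|]. *)
Definition norm_metric (V : Type) : Type := V.

Section norm_metric.
Variables (K : numFieldType) (V : normedModType K).
Local Notation T := (norm_metric V).

HB.instance Definition _ := PseudoMetric.copy T V.

Let dist (x y : T) : K := `|(x : V) - (y : V)|.

Let dist_ge0 x y : 0 <= dist x y. Proof. exact: normr_ge0. Qed.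

Let dist_eq0 x y : dist x y = 0 -> x = y.
Proof. by move/normr0_eq0/subr0_eq. Qed.

Let ballE (x : T) d : ball x d = [set y | dist x y < d].
Proof. by rewrite -[LHS]/(ball (x : V) d) -ball_normE. Qed.

HB.instance Definition _ :=
  PseudoMetric_isMetric.Build K T dist_ge0 dist_eq0 ballE.

Lemma norm_metricE (x y : norm_metric V) : mdist x y = `|(x : V) - (y : V)|.
Proof. by []. Qed.

End norm_metric.

(** The moduli are functions on [0, +oo[: only their restrictions to
    nonnegative reals are constrained. *)
Definition coarse_embedding (R : realType) (M N : metricType R)
    (phi : M -> N) : Prop :=
  exists rho omega : R -> R,
    [/\ forall t : R, 0 <= t -> 0 <= rho t /\ 0 <= omega t,
        forall s t : R, 0 <= s -> s <= t -> rho s <= rho t /\ omega s <= omega t,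
        rho t @[t --> +oo] --> +oo &
        forall x y, rho (mdist x y) <= mdist (phi x) (phi y) <=
                    omega (mdist x y)].

Definition coarsely_embeds (R : realType) (M N : metricType R) : Prop :=
  exists phi : M -> N, coarse_embedding phi.

(* Main.v *)
From HB Require Import structures.
Require Import Defs.
From mathcomp Require Import all_boot all_order all_algebra.
From mathcomp Require Import all_classical all_reals all_analysis.
From mathcomp Require Import lra ring.
Import Order.TTheory GRing.Theory Num.Theory.
Import numFieldNormedType.Exports.
Local Open Scope classical_set_scope.
Local Open Scope ring_scope.
Set Implicit Arguments.
Unset Strict Implicit.
Unset Printing Implicit Defensive.

(** Kalton's argument with iterated limits over interlacing sequences.  For a
    set [A] of integers and [n_1 < ... < n_k], let [f_A(n_1, ..., n_k)] be the
    element of [c_0] with [j]-th coordinate [#{i | j <= n_i}] for [j] in [A] and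
    [0] otherwise.  On interlacing tuples [f_A] varies by at most [1], whereas
    [f_A] and [f_B] are at distance [k] at all late tuples when [A <> B].

    If [phi] is a coarse embedding, take the limits of [phi o f_A] along a
    nonprincipal ultrafilter, one variable at a time.  Since [X = [e_i^*]^*] and
    [[e_i^*]] has finite codimension in [X^*], each limit enlarges [X] by
    finitely many scalars only, so the iterated limits live in the separable
    space [X x R^(kd)]; for uncountably many [A], two of them, for [A <> B], are
    as close as we like.  Let [h(s)] norm [phi f_A(s) - phi f_B(s)].  The
    interlaced iterated limit of [h(s)(phi f_A(t) - phi f_B(t))] is the value at
    the difference of the two limits of a functional of controlled norm, hence
    small; moving [t] to [s] costs [2 omega(1)].  So [rho(k) <= 2 omega(1) + 1]
    for all [k]. *)

(* A minimal sublinear functional is linear, so the Hahn-Banach theorem follows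
   from Zorn's lemma on sublinear functionals. *)
Section hahn_banach.
Variables (R : realType) (V : lmodType R).
Implicit Types (p q : V -> R) (x y v : V).

Definition sublinear q :=
  (forall x y, q (x + y) <= q x + q y) /\
  (forall t x, 0 < t -> q (t *: x) <= t * q x).

Lemma sublinear0 q : sublinear q -> q 0 = 0.
Proof.
move=> [qD qZ]; have := qD 0 0; have := qZ 2^-1 0.
by rewrite addr0 scaler0 invr_gt0 ltr0n => /(_ isT) ? ?; lra.
Qed.

Lemma sublinear_opp q x : sublinear q -> - q (- x) <= q x.
Proof.
move=> sq; have := sq.1 x (- x); rewrite subrr (sublinear0 sq) => ?; lra.
Qed.

(** The witness is the infimum over [t >= 0] of [q (x + t *: v) - t * q v], finite because each term
    is at least [- q (- x)]. Applied to a minimal [q], it forces [q (- v) = - q v]. *)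
Lemma sublinear_shift q v : sublinear q ->
  exists q', [/\ sublinear q', forall x, q' x <= q x & q' (- v) <= - q v].
Proof.
move=> sq; have [qD qZ] := sq.
pose S x := [set q (x + t *: v) - t * q v | t in [set t | 0 <= t]].
have lbS x (a : R) : S x a -> - q (- x) <= a.
  move=> [t /= t0 <-].
  have := qD (x + t *: v) (- x); rewrite addrAC subrr add0r.
  have : t * q v <= q (t *: v).
    move: t0; rewrite le_eqVlt => /predU1P[<-|t0].
      by rewrite scale0r (sublinear0 sq) mul0r.
    have := qZ t^-1 (t *: v); rewrite invr_gt0 t0 scalerA mulVf ?gt_eqF//.
    by rewrite scale1r => /(_ isT); rewrite ler_pdivlMl.
  move=> ? ?; lra.
have iS x : has_inf (S x).
  by split; [exists (q (x + 0 *: v) - 0 * q v), 0 => /=|exists (- q (- x)) => y /lbS].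
have infle x (a : R) : S x a -> inf (S x) <= a.
  by move=> Sa; apply: ge_inf => //; exact: (iS x).2.
have leinf x (a : R) : (forall z, S x z -> a <= z) -> a <= inf (S x).
  by move=> h; apply: lb_le_inf => //; exact: (iS x).1.
exists (fun x => inf (S x)); split; first split.
- move=> x y; rewrite -lerBlDr; apply/leinf => a [t /= t0 <-].
  rewrite lerBlDr -lerBlDl; apply/leinf => b [s /= s0 <-].
  apply: (@le_trans _ _ (q (x + y + (t + s) *: v) - (t + s) * q v -
      (q (x + t *: v) - t * q v))).
    by rewrite lerD2r; apply/infle; exists (t + s) => //=; rewrite addr_ge0.
  have := qD (x + t *: v) (y + s *: v); rewrite addrACA -scalerDl => ?; lra.
- move=> t x t0; rewrite -ler_pdivrMl//; apply/leinf => a [s /= s0 <-].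
  rewrite ler_pdivrMl//; apply: (@le_trans _ _ (q (t *: x + (t * s) *: v) - (t * s) * q v)).
    by apply/infle; exists (t * s) => //=; rewrite mulr_ge0// ltW.
  have := qZ t (x + s *: v) t0; rewrite scalerDr scalerA => ?; lra.
- by move=> x; apply/infle; exists 0 => //=; rewrite scale0r addr0 mul0r subr0.
- by apply/infle; exists 1 => //=; rewrite scale1r addNr (sublinear0 sq) mul1r add0r.
Qed.

(** Zorn's lemma for the reversed pointwise order: a chain is bounded by its pointwise infimum,
    which is finite because members below [p] stay above [- p (- x)]. *)
Lemma sublinear_minimal p : sublinear p -> exists q,
  [/\ sublinear q, forall x, q x <= p x &
   forall q', sublinear q' -> (forall x, q' x <= q x) ->
     forall x, q x <= q' x].
Proof.
move=> sp; pose P q := sublinear q /\ forall x, q x <= p x.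
pose T := {q : V -> R | P q}.
pose r (s t : T) := `[< forall x, sval t x <= sval s x >].
have p_T : P p by [].
have [||C totC|[q [sq qp]] qmin] := @ZL_preorder T (exist P p p_T) r.
- by move=> s; apply/asboolP.
- by move=> s t u /asboolP st /asboolP tu; apply/asboolP => x; exact: le_trans (st x).
- have [[t0 Ct0]|C0] := pselect (exists t, C t); last first.
    by exists (exist P p p_T) => s Cs; case: C0; exists s.
  pose S x := [set sval t x | t in C].
  have iS x : has_inf (S x).
    split; first by exists (sval t0 x), t0.
    exists (- p (- x)) => _ [t Ct <-]; have [st tp] := svalP t.
    have := sublinear_opp x st; have := tp (- x) => ? ?; lra.
  have infle x t : C t -> inf (S x) <= sval t x.
    by move=> Ct; apply: ge_inf; [exact: (iS x).2|exists t].
  have leinf x (a : R) : (forall t, C t -> a <= sval t x) -> a <= inf (S x).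
    move=> h; apply: lb_le_inf => //; first exact: (iS x).1.
    by move=> _ [t Ct <-]; exact: h.
  suff hq : sublinear (fun x => inf (S x)) /\ forall x, inf (S x) <= p x.
    by exists (exist P _ hq) => s Cs; apply/asboolP => x /=; exact: infle.
  split; last by move=> x; apply: (le_trans (infle _ _ Ct0)); exact: (svalP t0).2.
  split=> [x y|t x t_gt0].
  + rewrite -lerBlDr; apply/leinf => s Cs.
    rewrite lerBlDr -lerBlDl; apply/leinf => t Ct; rewrite lerBlDl.
    (* The smaller of the two members of the chain serves for both [x] and [y]. *)
    case: (totC _ _ Cs Ct) => /asboolP st.
    * apply: (le_trans (infle _ _ Ct)); apply: (le_trans ((svalP t).1.1 _ _)).
      by rewrite lerD2r.
    * apply: (le_trans (infle _ _ Cs)); apply: (le_trans ((svalP s).1.1 _ _)).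
      by rewrite lerD2l.
  + rewrite -ler_pdivrMl//; apply/leinf => s Cs; rewrite ler_pdivrMl//.
    by apply: (le_trans (infle _ _ Cs)); exact: (svalP s).1.2.
- exists q; split=> // q' sq' q'q x.
  have hq' : sublinear q' /\ forall x, q' x <= p x.
    by split=> // z; exact: le_trans (qp z).
  have /asboolP := qmin (exist P q' hq') (asboolT q'q); exact.
Qed.

(** Shifting [p] along [v] before minimizing secures [f (- v) <= - p v]. Minimality makes the
    functional odd, and an odd sublinear functional is linear. *)
Lemma hahn_banach_linear p v : sublinear p -> exists f : V -> R,
  [/\ forall x y, f (x + y) = f x + f y, forall a x, f (a *: x) = a * f x,
      forall x, f x <= p x & p v <= f v].
Proof.
move=> /(sublinear_shift v)[p' [sp' p'p p'v]].
have [q [sq qp' qmin]] := sublinear_minimal sp'; have [qD qZ] := sq.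
have qN x : q (- x) = - q x.
  have [q' [sq' q'q q'x]] := sublinear_shift x sq.
  have := qmin _ sq' q'q (- x); have := sublinear_opp x sq => ? ?.
  by apply/eqP; rewrite eq_le; apply/andP; split; [apply: le_trans q'x|rewrite lerNl].
have qZp t x : 0 < t -> q (t *: x) = t * q x.
  move=> t0; apply/eqP; rewrite eq_le qZ//=.
  by have := qZ t (- x) t0; rewrite scalerN !qN mulrN lerN2.
exists q; split.
- move=> x y; apply/eqP; rewrite eq_le qD/=.
  have := qD (x + y) (- y); rewrite addrK qN => ?; lra.
- move=> a x; have [a0|a0|->] := ltgtP a 0; last 2 first.
  + exact: qZp.
  + by rewrite scale0r mul0r sublinear0.
  + have := @qZp (- a) x; rewrite oppr_gt0 a0 scaleNr qN mulNr => /(_ isT).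
    exact: oppr_inj.
- by move=> x; apply: le_trans (p'p x).
- have := qp' (- v); rewrite qN => ?; lra.
Qed.

End hahn_banach.

(** * Norm estimates and norming functionals in the dual *)

Section dual_space_facts.
Variables (R : realType) (X : normedModType R).
Implicit Types (f : dual_space X) (x y : X).

Lemma dualD f x y : f (x + y) = f x + f y.
Proof. exact: linearD. Qed.

Lemma dualZ f a x : f (a *: x) = a * f x.
Proof. exact: linearZ. Qed.

Lemma dualB f x y : f (x - y) = f x - f y.
Proof. exact: linearB. Qed.

Lemma dual_bound f x : `|f x| <= `|f| * `|x|.
Proof.
have [->|x0] := eqVneq x 0; first by rewrite linear0 !normr0 mulr0.
have := @sup_abs_ge R X (@unit_ball R X) f (`|x|^-1 *: x) (dual_ubound f).
rewrite /unit_ball/= normrZ normfV normr_id mulVf ?normr_eq0// => /(_ (lexx _)).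
by rewrite dualZ normrM normfV normr_id ler_pdivrMl ?normr_gt0// mulrC.
Qed.

Lemma dual_norm_le f C : 0 <= C -> (forall x, `|f x| <= C * `|x|) -> `|f| <= C.
Proof.
move=> C0 fC; apply: sup_abs_le; first by exists 0; rewrite /unit_ball/= normr0.
by move=> x x1; apply: (le_trans (fC x)); rewrite ler_piMr.
Qed.

Lemma dual_exists (f : X -> R) C : 0 <= C ->
  (forall x y, f (x + y) = f x + f y) -> (forall a x, f (a *: x) = a * f x) ->
  (forall x, `|f x| <= C * `|x|) ->
  exists2 F : dual_space X, (forall x, F x = f x) & `|F| <= C.
Proof.
move=> C0 fD fZ fC.
have lf : linear (f : X -> R^o) by move=> a x y; rewrite fD fZ.
pose lin := GRing.isLinear.Build R X R^o _ (f : X -> R^o) lf.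
pose g : {linear X -> R^o} := HB.pack (f : X -> R^o) lin.
have cf : continuous (f : X -> R^o).
  apply: (@bounded_linear_continuous R X R^o g); apply/bounded_funP => r.
  by exists (C * r) => x xr; apply: (le_trans (fC x)); rewrite ler_wpM2l.
have fd : (f : X -> R) \in @clinear R X by apply/asboolP.
by exists (Dual fd) => //; exact: dual_norm_le.
Qed.

(** Hahn-Banach with the norm itself as the sublinear functional. *)
Lemma dual_norming x : exists2 f : dual_space X, `|f| <= 1 & `|x| <= f x.
Proof.
have sn : sublinear (fun x : X => `|x|).
  split=> [y z|t y t0]; first exact: ler_normD.
  by rewrite normrZ gtr0_norm.
have [f [fD fZ fn fx]] := hahn_banach_linear x sn.
have fN y : f (- y) = - f y by rewrite -scaleN1r fZ mulN1r.
have [|F Ff F1] := dual_exists ler01 fD fZ; last by exists F => //; rewrite Ff.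
by move=> y; rewrite mul1r ler_norml fn andbT lerNl -fN -(normrN y) fn.
Qed.

End dual_space_facts.

(** * Limits of bounded real sequences along an ultrafilter *)

Section ultralimits.
Variables (R : realType) (U : set_system nat).
Hypothesis UU : UltraFilter U.

(** Compactness of [[- B, B]] gives a cluster point of the image of [U], and a cluster point of an
    ultrafilter is a limit. *)
Lemma ultra_cvg_bounded (u : nat -> R) (B : R) : (forall n, `|u n| <= B) ->
  exists2 l, `|l| <= B & u n @[n --> U] --> l.
Proof.
move=> uB.
have uBn n : `[- B, B]%classic (u n) by rewrite /= in_itv/= -ler_norml.
have : (u n @[n --> U]) `[- B, B]%classic by apply: (@filterE nat U) => n; exact: uBn.
move=> /(@segment_compact R (- B) B)[l []].
rewrite /= in_itv/= -ler_norml => lB cl; exists l => // A Al.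
have [//|UA] := in_ultra_setVsetC (u @^-1` A) UU.
by have [x [nAx Ax]] := cl (~` A) A UA Al; case: (nAx Ax).
Qed.

End ultralimits.

(** * Closed subspaces and their finite-dimensional extensions *)

Section subspaces.
Variables (R : realType) (V : normedModType R).
Implicit Types (A Y : set V) (s : seq V).

Lemma closure_normP A v :
  closure A v <-> forall eps : R, 0 < eps -> exists2 y, A y & `|v - y| < eps.
Proof.
split=> [cA eps e0|h B /nbhs_normP[eps /= e0 sB]].
  have [y [Ay vy]] := cA _ (nbhsx_ballx v eps e0).
  by exists y => //; move: vy; rewrite -ball_normE.
by have [y Ay vy] := h _ e0; exists y; split => //; exact: sB.
Qed.

Definition subspace A := A 0 /\ forall a x y, A x -> A y -> A (a *: x + y).

Lemma subspaceZ A a x : subspace A -> A x -> A (a *: x).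
Proof. by move=> [A0 AD] Ax; rewrite -[_ *: _]addr0; exact: AD. Qed.

Lemma subspaceD A x y : subspace A -> A x -> A y -> A (x + y).
Proof. by move=> [_ AD] Ax Ay; rewrite -[x]scale1r; exact: AD. Qed.

Lemma lin_span_subspace A : subspace (lin_span A).
Proof.
split; first by exists 0%N, (fun=> 0), (fun=> 0); split=> [[]|]//; rewrite big_ord0.
move=> a _ _ [n [b [v [Av ->]]]] [m [c [w [Aw ->]]]].
exists (n + m)%N, (fun i => match fintype.split i with inl j => a * b j | inr j => c j end),
  (fun i => match fintype.split i with inl j => v j | inr j => w j end); split.
  by move=> i; case: fintype.split.
rewrite big_split_ord/= scaler_sumr; congr +%R; apply: eq_bigr => i _.
  by rewrite (unsplitK (inl i)) scalerA.
by rewrite (unsplitK (inr i)).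
Qed.

Lemma lin_span_min A Y : subspace Y -> A `<=` Y -> lin_span A `<=` Y.
Proof.
move=> sY AY _ [n [a [w [Aw ->]]]].
elim/big_ind: _ => //; first exact: sY.1.
- by move=> x y; exact: subspaceD.
- by move=> i _; apply: subspaceZ => //; exact: AY.
Qed.

Lemma closure_subspace A : subspace A -> subspace (closure A).
Proof.
move=> [A0 AD]; split; first exact: subset_closure.
move=> a x y /closure_normP cx /closure_normP cy; apply/closure_normP => eps e0.
have e1 : 0 < eps / 2 / (`|a| + 1) by rewrite !divr_gt0// ltr_wpDl.
have [x' Ax' xx'] := cx _ e1.
have [y' Ay' yy'] := cy (eps / 2) (divr_gt0 e0 (ltr0Sn _ 1)).
exists (a *: x' + y'); first exact: AD.
rewrite opprD addrACA -scalerBr (le_lt_trans (ler_normD _ _))// normrZ.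
rewrite ltr_pdivlMr ?ltr_wpDl// in xx'.
have : `|a| * `|x - x'| <= `|x - x'| * (`|a| + 1).
  by rewrite mulrDr mulr1 mulrC lerDl.
move=> ?; lra.
Qed.

(** Here [d] is a positive lower bound for the distance from [z] to [Y]; homogeneity gives the
    factor [|a|]. *)
Lemma closed_subspace_dist Y z : subspace Y -> closed Y -> ~ Y z ->
  exists2 d : R, 0 < d & forall a y, Y y -> `|a| * d <= `|y + a *: z|.
Proof.
move=> sY cY Yz.
have [d d0 dY] : exists2 d : R, 0 < d & forall y, Y y -> d <= `|z - y|.
  apply: contrapT => h; apply: Yz; apply: cY; apply/closure_normP => eps e0.
  apply: contrapT => h'; apply: h; exists eps => // y Yy.
  by rewrite leNgt; apply/negP => zy; apply: h'; exists y.
exists d => // a y Yy; have [->|a0] := eqVneq a 0; first by rewrite normr0 mul0r.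
have := dY _ (subspaceZ (- a^-1) sY Yy).
rewrite scaleNr opprK -(ler_pM2l (_ : 0 < `|a|)) ?normr_gt0// -normrZ.
by rewrite scalerDr scalerA mulfV// scale1r addrC.
Qed.

Lemma subspace_line Y z : subspace Y ->
  subspace [set v | exists a : R, Y (v - a *: z)].
Proof.
move=> [Y0 YD]; split; first by exists 0; rewrite scale0r subr0.
move=> a x y [b Yb] [c Yc]; exists (a * b + c).
by rewrite scalerDl opprD addrACA -scalerA -scalerBr; exact: YD.
Qed.

(** The set is [Y + R z]. The [z]-coefficients of approximants of [w] are bounded by the distance
    estimate, so they have a limit [l] along an ultrafilter, and [w - l *: z] lies in [Y] by
    closedness. *)
Lemma closed_line Y z : subspace Y -> closed Y -> ~ Y z ->
  closed [set v | exists a : R, Y (v - a *: z)].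
Proof.
move=> sY cY Yz; have [d d0 dY] := closed_subspace_dist sY cY Yz.
move=> w /closure_normP cw.
have /choice[v vP] n : exists v, (exists a : R, Y (v - a *: z)) /\ `|w - v| < n.+1%:R^-1.
  have := cw n.+1%:R^-1; rewrite invr_gt0 ltr0n => /(_ isT)[v Yv wv].
  by exists v.
have /choice[a aP] n : exists a : R, Y (v n - a *: z) by case: (vP n).
have [U [UU sU]] := ultraFilterLemma eventually_filter.
have ab n : `|a n| <= (`|w| + 1) / d.
  rewrite ler_pdivlMr// (le_trans (dY (a n) _ (aP n)))// subrK.
  have -> : v n = w - (w - v n) by rewrite opprB addrCA subrr addr0.
  rewrite (le_trans (ler_normB _ _))// lerD2l (le_trans (ltW (vP n).2))//.
  by rewrite invf_le1// ler1n.
have [l _ al] := ultra_cvg_bounded UU ab; exists l; apply: cY.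
apply/closure_normP => eps e0.
have e1 : 0 < eps / 2 / (`|z| + 1) by rewrite !divr_gt0// ltr_wpDl.
have : \forall n \near U, (`|l - a n| < eps / 2 / (`|z| + 1)) /\ n.+1%:R^-1 < eps / 2.
  apply: filterS2 (fun x h1 h2 => conj h1 h2) _ _.
    by move/cvgrPdist_lt : al; apply.
  by apply: sU; exact: near_infty_natSinv_lt (PosNum (divr_gt0 e0 (ltr0Sn R 1))).
move=> /filter_ex[n [ln ne]]; exists (v n - a n *: z); first exact: aP.
have -> : w - l *: z - (v n - a n *: z) = (w - v n) - (l - a n) *: z.
  by rewrite scalerBl !opprB addrACA [RHS]addrACA; congr +%R; rewrite addrC.
rewrite (le_lt_trans (ler_normB _ _))// normrZ.
rewrite ltr_pdivlMr ?ltr_wpDl// in ln.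
rewrite [ltRHS]splitr ltrD//; first exact: lt_trans (vP n).2 ne.
by apply: le_lt_trans ln; rewrite ler_wpM2l// lerDl.
Qed.

(** Induction on [s] with [Y] varying: if [z] is in [Y], its coefficient is reset to [0]; otherwise
    [Y] grows to the closed subspace [Y + R z]. Since [s] may be dependent modulo [Y], new
    coefficients are chosen instead of bounding the given ones. *)
Lemma bounded_coefficients s Y : subspace Y -> closed Y ->
  exists2 K : R, 0 <= K & forall h,
    (exists a : nat -> R, Y (h - \sum_(i < size s) a i *: s`_i)) ->
    exists2 a : nat -> R, Y (h - \sum_(i < size s) a i *: s`_i) &
      forall i, `|a i| <= K * `|h|.
Proof.
elim: s Y => [|z s IH] Y sY cY.
  exists 0 => // h [a]; rewrite big_ord0 => Yh.
  by exists (fun=> 0); [rewrite big_ord0|move=> i; rewrite normr0 mul0r].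
have [Yz|Yz] := pselect (Y z).
  have [K K0 KY] := IH Y sY cY; exists K => // h [a].
  rewrite big_ord_recl/= => Yh.
  have [|b Yb bK] := KY h.
    exists (fun i => a i.+1).
    have := subspaceD sY (subspaceZ (a 0%N) sY Yz) Yh.
    by rewrite addrCA opprD addNKr.
  exists (fun i => if i is j.+1 then b j else 0).
    by rewrite big_ord_recl/= scale0r add0r.
  by case=> [|i]; rewrite ?normr0 ?mulr_ge0.
have [d d0 dY] := closed_subspace_dist sY cY Yz.
have [K K0 KY] := IH _ (subspace_line z sY) (closed_line sY cY Yz).
pose S := \sum_(i < size s) `|s`_i|.
have S0 : 0 <= S by exact: sumr_ge0.
have KS0 : 0 <= (1 + K * S) / d.
  by rewrite divr_ge0 ?(ltW d0)// addr_ge0// mulr_ge0.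
exists (K + (1 + K * S) / d); first exact: addr_ge0.
move=> h [a]; rewrite big_ord_recl/= => Yh.
have [|b [c Yc] bK] := KY h.
  by exists (fun i => a i.+1), (a 0%N); rewrite -addrA -opprD [_ + a 0%N *: z]addrC.
exists (fun i => if i is j.+1 then b j else c).
  by rewrite big_ord_recl/= opprD addrA addrAC.
case=> [|i]; last by rewrite (le_trans (bK i))// ler_wpM2r// lerDl.
apply: (@le_trans _ _ ((1 + K * S) / d * `|h|)); last by rewrite ler_wpM2r// lerDr.
(* The distance estimate bounds [|c| * d] by the norm of [h] minus the combination with coefficients
   [b], hence by [(1 + K * S) * |h|]. *)
rewrite mulrAC ler_pdivlMr//; have := dY c _ Yc; rewrite subrK => /le_trans.
apply; rewrite (le_trans (ler_normB _ _))// mulrDl mul1r lerD2l.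
rewrite (le_trans (ler_norm_sum _ _ _))// /S mulr_sumr mulr_suml ler_sum// => i _.
by rewrite normrZ mulrAC ler_wpM2r.
Qed.

Lemma lin_span_seq s x : lin_span [set` s] x ->
  exists a : nat -> R, x = \sum_(i < size s) a i *: s`_i.
Proof.
apply: (@lin_span_min _ [set x | exists a : nat -> R, x = \sum_(i < size s) a i *: s`_i]).
  split; first by exists (fun=> 0); rewrite big1// => i _; rewrite scale0r.
  move=> a _ _ [b ->] [c ->]; exists (fun i => a * b i + c i).
  rewrite scaler_sumr -big_split/=; apply: eq_bigr => i _.
  by rewrite scalerDl scalerA.
move=> v /= vs; have iv : (index v s < size s)%N by rewrite index_mem.
exists (fun i => (i == index v s)%:R).
rewrite (bigD1 (Ordinal iv))//= eqxx scale1r nth_index// big1 ?addr0// => i.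
by rewrite -val_eqE/= => /negbTE ->; rewrite scale0r.
Qed.

End subspaces.

(** * Limits of sums, norms and functionals along a filter *)

Section filter_limits.
Variables (R : realType) (V : normedModType R).

Lemma cvg_sumr (T I : Type) (F : set_system T) {FF : Filter F} (r : seq I)
    (P : pred I) (f : I -> T -> V) (l : I -> V) :
  (forall i, P i -> f i t @[t --> F] --> l i) ->
  \sum_(i <- r | P i) f i t @[t --> F] --> \sum_(i <- r | P i) l i.
Proof. by apply: cvg_big; exact: add_continuous. Qed.

Lemma norm_cvg_le (T : Type) (F : set_system T) {FF : ProperFilter F}
    (f : T -> V) (l : V) (B : R) :
  (forall t, `|f t| <= B) -> f t @[t --> F] --> l -> `|l| <= B.
Proof.
move=> fB /cvgrPdist_lt fl; apply/ler_addgt0Pr => eps e0.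
have /filter_ex[t lt_e] := fl _ e0.
rewrite -(subrK (f t) l) (le_trans (ler_normD _ _))// addrC.
by rewrite lerD// ltW.
Qed.

Lemma dual_cvg (T : Type) (F : set_system T) {FF : Filter F}
    (f : T -> V) (l : V) (y : dual_space V) :
  f t @[t --> F] --> l -> y (f t) @[t --> F] --> y l.
Proof.
by move=> fl; apply: (@continuous_cvg _ _ R^o _ _ f y l) => //; exact: dual_continuous.
Qed.

End filter_limits.

(** * Basis projections and weak-* compactness *)

Section basis.
Variables (R : realType) (X : completeNormedModType R).
Variables (e : nat -> X) (estar : nat -> dual_space X).
Hypothesis basis_e : schauder_basis e.
Hypothesis estarE : biorthogonal e estar.

Lemma estar_series (a : nat -> R) j n :
  estar j (series (fun i => a i *: e i) n) = if (j < n)%N then a j else 0.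
Proof.
rewrite /series/= linear_sum/= big_mkord; case: ifPn => jn.
  rewrite (bigD1 (Ordinal jn))//= dualZ estarE eqxx mulr1 big1 ?addr0// => i.
  rewrite -val_eqE/= eq_sym => /negbTE ij.
  by rewrite dualZ estarE ij mulr0.
rewrite big1// => i _; rewrite dualZ estarE; case: eqP => [ji|_]; last by rewrite mulr0.
by rewrite ji ltn_ord in jn.
Qed.

(** On partial sums past [j] the functional [estar j] is constantly [a j]; continuity carries this
    to the limit. *)
Lemma estar_cvg_series (a : nat -> R) x j :
  series (fun i => a i *: e i) @ \oo --> x -> estar j x = a j.
Proof.
move=> /(@dual_cvg _ _ _ _ _ _ _ (estar j)) ax.
apply: (@cvg_unique _ (@norm_hausdorff _ R)
  (estar j (series (fun i => a i *: e i) n) @[n --> \oo])) => //.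
apply: cvg_near_cst; near=> n; rewrite estar_series ifT//.
by near: n; exact: nbhs_infty_gt.
Unshelve. all: by end_near. Qed.

Definition basis_proj n x := series (fun i => estar i x *: e i) n.

Lemma basis_proj_cvg x : basis_proj n x @[n --> \oo] --> x.
Proof.
have [a [ax _]] := basis_e x; rewrite /basis_proj.
suff -> : (fun n => series (fun i => estar i x *: e i) n) =
          series (fun i => a i *: e i) by [].
by apply/funext => n; apply: eq_bigr => i _; rewrite (estar_cvg_series _ ax).
Qed.

(** Uniform boundedness principle: the projections converge pointwise, hence are pointwise
    bounded. *)
Lemma basis_constant : exists2 K : R, 0 <= K & forall n x, `|basis_proj n x| <= K * `|x|.
Proof.
have lin n : linear (basis_proj n).
  move=> a x y; rewrite /basis_proj /series/= scaler_sumr -big_split/=.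
  by apply: eq_bigr => i _; rewrite dualD dualZ scalerDl scalerA.
(* A crude bound depending on [n], which shows that each single projection is bounded. *)
have nle n x : `|basis_proj n x| <= (\sum_(0 <= i < n) `|estar i| * `|e i|) * `|x|.
  rewrite /basis_proj /series/= (le_trans (ler_norm_sum _ _ _))// mulr_suml.
  by apply: ler_sum => i _; rewrite normrZ mulrAC ler_wpM2r// dual_bound.
have [| |M MP] := @Banach_Steinhauss R X X (range basis_proj) _ _ 1.
- move=> _ [n _ <-]; split; last exact: lin.
  move=> r; exists ((\sum_(0 <= i < n) `|estar i| * `|e i|) * r) => x xr.
  rewrite (le_trans (nle n x))// ler_wpM2l//; apply: sumr_ge0 => i _.
  exact: mulr_ge0.
- move=> x; have /cvg_seq_bounded/pinfty_ex_gt0[M _ MP] := cvgP _ (@basis_proj_cvg x).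
  by exists M => _ [n _ <-]; exact: MP.
have M0 : 0 <= M.
  apply: le_trans (normr_ge0 _) (MP (basis_proj 0) _ 0 _); rewrite ?normr0//.
exists M => // n x; have [->|x0] := eqVneq x 0.
  by rewrite (le_trans (nle _ _))// normr0 !mulr0.
have := MP (basis_proj n) (imageT _ _) (`|x|^-1 *: x).
rewrite normrZ normfV normr_id mulVf ?normr_eq0// => /(_ (lexx _)).
have -> : basis_proj n (`|x|^-1 *: x) = `|x|^-1 *: basis_proj n x.
  rewrite /basis_proj /series/= scaler_sumr; apply: eq_bigr => i _.
  by rewrite dualZ scalerA.
rewrite normrZ normfV normr_id -ler_pdivlMl ?invr_gt0 ?normr_gt0//.
by rewrite invrK mulrC.
Qed.

Section weak_star.
Variable U : set_system nat.
Hypothesis UU : UltraFilter U.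

(* Bounded completeness makes [X] the dual of [[e_i^*]]; this is weak-*
   compactness of its balls. *)
Lemma bounded_weak_star_limit : boundedly_complete e ->
  exists2 K : R, 0 <= K & forall (B : R) (u : nat -> X), (forall n, `|u n| <= B) ->
  exists2 x : X, forall B', (forall n, `|u n| <= B') -> `|x| <= K * B' &
    forall y, closed_span (range estar) y -> y (u n) @[n --> U] --> y x.
Proof.
move=> bc; have [K K0 KP] := basis_constant; exists K => // B u uB.
have B0 : 0 <= B := le_trans (normr_ge0 _) (uB 0%N).
have /choice[a aP] i : exists l : R, estar i (u n) @[n --> U] --> l.
  have [|l _ ul] := @ultra_cvg_bounded R U UU (fun n => estar i (u n)) (`|estar i| * B).
    by move=> n; rewrite (le_trans (dual_bound _ _))// ler_wpM2l.
  by exists l.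
(* With [a i] the limit of the [i]-th coordinates of [u n], a partial sum is the norm limit of the
   projections of [u n]. Any bound [B'] of the sequence is allowed, so [x] inherits all of them. *)
have aB B' N : (forall n, `|u n| <= B') -> `|series (fun i => a i *: e i) N| <= K * B'.
  move=> uB'; have : basis_proj N (u n) @[n --> U] --> series (fun i => a i *: e i) N.
    rewrite /basis_proj /series/=; apply: cvg_sumr => i _.
    by apply: cvgZ; [exact: aP|exact: cvg_cst].
  apply: norm_cvg_le => n.
  by rewrite (le_trans (KP _ _))// ler_wpM2l.
have /bc/cvg_ex[x ax] : bounded_fun (series (fun i => a i *: e i)).
  exists (K * B); split; first exact: num_real.
  by move=> M KM N _; exact: le_trans (aB B N uB) (ltW KM).
have xB B' : (forall n, `|u n| <= B') -> `|x| <= K * B'.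
  by move=> uB'; apply: norm_cvg_le ax => N; exact: aB.
exists x => // y /closure_normP cy.
have span_cvg z : lin_span (range estar) z -> z (u n) @[n --> U] --> z x.
  move=> [m [b [w [wr ->]]]].
  have sumE v : (\sum_(i < m) b i *: w i : dual_space X) v = \sum_(i < m) b i * w i v.
    elim/big_ind2 : _ => //= f1 r1 f2 r2 <- <-; exact: erefl.
  under eq_fun do rewrite sumE; rewrite sumE.
  apply: cvg_sumr => i _; apply: cvgM; first exact: cvg_cst.
  have [j _ <-] := wr i; rewrite (estar_cvg_series _ ax); exact: aP.
apply/cvgrPdist_lt => eps e0.
(* Since [|u n| + |x| <= B + K * B], replacing [y] by an element [z] of the span within
   [eps / 2 / D] costs at most [eps / 2] at [u n] and [x] together. *)
pose D := B + K * B + 1.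
have D0 : 0 < D by rewrite ltr_wpDl// addr_ge0// mulr_ge0.
have [z zs yz] := cy (eps / 2 / D) (divr_gt0 (divr_gt0 e0 (ltr0Sn _ 1)) D0).
have /cvgrPdist_lt/(_ _ (divr_gt0 e0 (ltr0Sn _ 1))) := span_cvg z zs.
apply: filterS => n zn.
have yzb v : `|y v - z v| <= eps / 2 / D * `|v|.
  by rewrite (le_trans (dual_bound (y - z) v))// ler_wpM2r// ltW.
have := yzb x; have := yzb (u n); have xKB := xB B uB.
have : eps / 2 / D * `|u n| + eps / 2 / D * `|x| <= eps / 2.
  rewrite -mulrDr mulrAC ler_pdivrMr// ler_pM2l ?divr_gt0//.
  by rewrite /D -addrA lerD// ler_wpDr.
move=> h1 h2 h3.
have -> : y x - y (u n) = (y x - z x) + (z x - z (u n)) - (y (u n) - z (u n)) by ring.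
rewrite (le_lt_trans (ler_normB _ _))// (le_lt_trans (lerD (ler_normD _ _) (lexx _)))//.
lra.
Qed.

End weak_star.

End basis.

(* With [coef h] the coordinates along [Z] of [h] in [X^* = [e_i^*] + Z], weak-*
   limits in [X^**] of bounded sequences of [X] are represented by an element
   of [X] and [d] scalars. *)
Definition finite_codim_limits (R : realType) (X : completeNormedModType R)
    (U : set_system nat) (d : nat) (K : R) (coef : dual_space X -> nat -> R) : Prop :=
  [/\ 0 <= K, forall h j, `|coef h j| <= K * `|h| &
  forall (B : R) (u : nat -> X), (forall n, `|u n| <= B) ->
  exists p : X * (nat -> R),
    (forall B', (forall n, `|u n| <= B') ->
      `|p.1| <= K * B' /\ forall j, `|p.2 j| <= K * B') /\
    forall h : dual_space X, h (u n) @[n --> U] --> h p.1 + \sum_(j < d) coef h j * p.2 j].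

(** * Weak-* limits in the bidual of [X] *)

Section bidual.
Variables (R : realType) (X : completeNormedModType R).
Variables (e : nat -> X) (estar : nat -> dual_space X) (Z : set (dual_space X)).
Hypothesis basis_e : schauder_basis e.
Hypothesis bc_e : boundedly_complete e.
Hypothesis estarE : biorthogonal e estar.
Hypothesis finZ : fin_dim_subspace Z.
Hypothesis sumZ : direct_sum (closed_span (range estar)) Z.

(** Split [h] into a part in [[e_i^*]], whose values converge to its value at the weak-* limit [x],
    and a combination of the spanning functionals [s] of [Z], whose values converge to numbers
    [l j]. *)
Lemma finite_codim_limits_exists U : UltraFilter U ->
  exists d K (coef : dual_space X -> nat -> R), finite_codim_limits U d K coef.
Proof.
move=> UU; case: finZ => B /finite_seqP[s ->] ZE.
pose Y := closed_span (range estar).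
have sY : subspace Y by apply: closure_subspace; exact: lin_span_subspace.
have cY : closed Y by exact: closed_closure.
have [K K0 KP] := bounded_coefficients s sY cY.
have /choice[coef coefP] (h : dual_space X) : exists a : nat -> R,
    Y (h - \sum_(i < size s) a i *: s`_i) /\ forall i, `|a i| <= K * `|h|.
  have [|a Ya aK] := KP h; last by exists a.
  have : setT h by []; rewrite -sumZ.1 => -[y Yy [z]]; rewrite ZE.
  by move=> /lin_span_seq[a ->] <-; exists a; rewrite addrK.
have [L L0 LP] := bounded_weak_star_limit basis_e estarE UU bc_e.
pose S := \sum_(i < size s) `|s`_i|.
have S0 : 0 <= S by exact: sumr_ge0.
have sS j : `|s`_j| <= S.
  have [js|js] := ltnP j (size s); last by rewrite nth_default// normr0.
  by rewrite /S (bigD1 (Ordinal js))//= lerDl sumr_ge0.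
(* One constant for three bounds: [K] for [coef], [L] for the point of [X], and [S * (1 + L)] for
   the scalars. *)
exists (size s), (K + L + S * (1 + L)), coef; split.
- by rewrite !addr_ge0// mulr_ge0// addr_ge0.
- move=> h j; rewrite (le_trans ((coefP h).2 j))// ler_wpM2r//.
  by rewrite -addrA lerDl addr_ge0// mulr_ge0// addr_ge0.
- move=> B' u uB'; have [x xL xY] := LP _ _ uB'.
  have /choice[l lP] j : exists l : R, s`_j (u n) @[n --> U] --> l.
    have [|l _ ul] := @ultra_cvg_bounded R U UU (fun n => s`_j (u n)) (`|s`_j| * B').
      by move=> n; rewrite (le_trans (dual_bound _ _))// ler_wpM2l.
    by exists l.
  exists (x, fun j => l j - s`_j x) => /=; split=> [C uC|h].
    have C0 : 0 <= C := le_trans (normr_ge0 _) (uC 0%N).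
    split=> [|j].
      rewrite (le_trans (xL _ uC))// ler_wpM2r//.
      by rewrite addrAC lerDr addr_ge0// mulr_ge0// addr_ge0.
    have lC : `|l j| <= S * C.
      apply: (@norm_cvg_le R R^o _ _ _ _ _ _ _ (lP j)) => n.
      by rewrite (le_trans (dual_bound _ _))// ler_pM.
    have sC : `|s`_j x| <= S * (L * C).
      by rewrite (le_trans (dual_bound _ _))// ler_pM// xL.
    rewrite (le_trans (ler_normB _ _))// (le_trans (lerD lC sC))//.
    by rewrite -mulrDr -[X in X + L * C]mul1r -mulrDl mulrA ler_wpM2r// lerDr addr_ge0.
  have hE v : h v = (h - \sum_(i < size s) coef h i *: s`_i) v +
      \sum_(i < size s) coef h i * s`_i v.
    have sumE : (\sum_(i < size s) coef h i *: s`_i : dual_space X) v =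
        \sum_(i < size s) coef h i * s`_i v.
      elim/big_ind2 : _ => //= f1 r1 f2 r2 <- <-; exact: erefl.
    by rewrite -sumE /= subrK.
  under eq_fun do rewrite hE.
  suff -> : h x + \sum_(j < size s) coef h j * (l j - s`_j x) =
      (h - \sum_(i < size s) coef h i *: s`_i) x + \sum_(i < size s) coef h i * l i.
    apply: cvgD; first by apply: xY; exact: (coefP h).1.
    by apply: cvg_sumr => i _; apply: cvgM; [exact: cvg_cst|exact: lP].
  rewrite [h x]hE -addrA -big_split/=; congr +%R; apply: eq_bigr => i _; ring.
Qed.

End bidual.

(** * Interlaced tuples and iterated ultrafilter quantifiers *)

Section interlacing.
Variable U : set_system nat.
Hypothesis UU : UltraFilter U.

Fixpoint interlaced l (s t : seq nat) : bool :=
  match s, t with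
  | m :: s', n :: t' => [&& (l <= m)%N, (m <= n)%N & interlaced n s' t']
  | [::], [::] => true
  | _, _ => false
  end.

(** The entries of the two tuples are quantified alternately, in the order in which interlaced
    tuples increase. *)
Fixpoint iter_near k (P : seq nat -> seq nat -> Prop) : Prop :=
  if k is k'.+1 then
    \forall m \near U, \forall n \near U,
      iter_near k' (fun s t => P (m :: s) (n :: t))
  else P [::] [::].

Lemma iter_nearS k (P Q : seq nat -> seq nat -> Prop) :
  (forall s t, P s t -> Q s t) -> iter_near k P -> iter_near k Q.
Proof.
elim: k P Q => [|k IH] P Q PQ /=; first exact: PQ.
apply: filterS => m; apply: filterS => n; apply: IH => s t; exact: PQ.
Qed.

Lemma iter_nearI k (P Q : seq nat -> seq nat -> Prop) :
  iter_near k P -> iter_near k Q -> iter_near k (fun s t => P s t /\ Q s t).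
Proof.
elim: k P Q => [|k IH] P Q /=; first by split.
by apply: filterS2 => m; apply: filterS2 => n; exact: IH.
Qed.

(** As [U] contains all tails, each entry can be picked beyond the preceding one. *)
Lemma iter_near_interlaced k (P : seq nat -> seq nat -> Prop) l :
  \oo `<=` U -> iter_near k P ->
  exists s t, [/\ size s = k, interlaced l s t & P s t].
Proof.
move=> oU; elim: k P l => [|k IH] P l /=; first by exists [::], [::].
move=> /(filterI (oU _ (nbhs_infty_ge l)))/filter_ex[m [/= lm]].
move=> /(filterI (oU _ (nbhs_infty_ge m)))/filter_ex[n [/= mn]].
move=> /(IH _ n)[s [t [sk st Pst]]].
by exists (m :: s), (n :: t); rewrite /= sk lm mn.
Qed.

End interlacing.

(** * Ultrafilter limits of scalars and of functionals *)

Section ulim.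
Variables (R : realType) (U : set_system nat).
Hypothesis UU : UltraFilter U.

Definition ulim (u : nat -> R) : R := lim (u n @[n --> U]).

Lemma ulimP (u : nat -> R) (B : R) : (forall n, `|u n| <= B) ->
  u n @[n --> U] --> ulim u /\ `|ulim u| <= B.
Proof.
move=> uB; have [l lB ul] := ultra_cvg_bounded UU uB.
by rewrite /ulim (cvg_lim (@norm_hausdorff _ R) ul).
Qed.

(** Banach-Alaoglu along [U]: the pointwise limit is linear and keeps the bound [C]. *)
Lemma dual_weak_star_limit (X : normedModType R) (f : nat -> dual_space X) (C : R) :
  (forall n, `|f n| <= C) ->
  exists2 F : dual_space X, `|F| <= C & forall x, f n x @[n --> U] --> F x.
Proof.
move=> fC; have C0 : 0 <= C := le_trans (normr_ge0 _) (fC 0%N).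
have fP x := @ulimP (fun n => f n x) (C * `|x|)
  (fun n => le_trans (dual_bound _ _) (ler_wpM2r (normr_ge0 x) (fC n))).
have [|||F FE FC] := @dual_exists R X (fun x => ulim (fun n => f n x)) C C0.
- move=> x y; apply: (cvg_lim (@norm_hausdorff _ R)).
  by under eq_fun do rewrite dualD; apply: cvgD; exact: (fP _).1.
- move=> a x; apply: (cvg_lim (@norm_hausdorff _ R)).
  by under eq_fun do rewrite dualZ; apply: cvgM; [exact: cvg_cst|exact: (fP _).1].
- by move=> x; exact: (fP x).2.
by exists F => // x; rewrite FE; exact: (fP x).1.
Qed.

End ulim.

(** * Iterated limits in [X x R^(kd)] and their pairing with functionals *)

Section iterated_limits.
Variables (R : realType) (X : completeNormedModType R) (U : set_system nat).
Hypothesis UU : UltraFilter U.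
Variables (d : nat) (K : R) (coef : dual_space X -> nat -> R).
Hypothesis codimX : finite_codim_limits U d K coef.

Let K0 : 0 <= K. Proof. by case: codimX. Qed.

Let coef_le h j : `|coef h j| <= K * `|h|. Proof. by case: codimX. Qed.

(** The limit is chosen for every sequence, with value [0] on unbounded ones, so that [iter_lim] can
    be a total recursive function. *)
Lemma bidual_limit_exists : exists W : (nat -> X) -> X * (nat -> R),
  forall u B, (forall n, `|u n| <= B) ->
  [/\ `|(W u).1| <= K * B, forall j, `|(W u).2 j| <= K * B &
    forall h : dual_space X,
      h (u n) @[n --> U] --> h (W u).1 + \sum_(j < d) coef h j * (W u).2 j].
Proof.
have /choice[W WP] (u : nat -> X) : exists p : X * (nat -> R),
    forall B, (forall n, `|u n| <= B) -> [/\ `|p.1| <= K * B, forall j, `|p.2 j| <= K * B &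
    forall h : dual_space X, h (u n) @[n --> U] --> h p.1 + \sum_(j < d) coef h j * p.2 j].
  have [[B uB]|nB] := pselect (exists B, forall n, `|u n| <= B).
    have [_ _ /(_ _ _ uB)[p [pB ph]]] := codimX; exists p => B' uB'.
    by have [? ?] := pB _ uB'; split.
  by exists (0, fun=> 0) => B uB; case: nB; exists B.
by exists W.
Qed.

Variable W : (nat -> X) -> X * (nat -> R).
Hypothesis WP : forall u B, (forall n, `|u n| <= B) ->
  [/\ `|(W u).1| <= K * B, forall j, `|(W u).2 j| <= K * B &
    forall h : dual_space X,
      h (u n) @[n --> U] --> h (W u).1 + \sum_(j < d) coef h j * (W u).2 j].

(** The limit in the first variable is taken last. For [i < k], row [i] comes from the scalars
    created by the limit in the variable that has [i] others after it. *)
Fixpoint iter_lim k (g : seq nat -> X) : X * (nat -> nat -> R) :=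
  if k is k'.+1 then
    let t n := iter_lim k' (fun s => g (n :: s)) in
    let w := W (fun n => (t n).1) in
    (w.1, fun i => if i == k' then w.2 else fun j => ulim U (fun n => (t n).2 i j))
  else (g [::], fun _ _ => 0).

Lemma iter_lim_bounded k B : exists B', forall g, (forall s, `|g s| <= B) ->
  `|(iter_lim k g).1| <= B' /\ forall i j, `|(iter_lim k g).2 i j| <= B'.
Proof.
elim: k => [|k [B' IH]].
  exists B => g gB /=; split=> [|_ _]; first exact: gB.
  by rewrite normr0 (le_trans (normr_ge0 _) (gB [::])).
exists (Num.max B' (K * B')) => g gB.
have tB n := IH (fun s => g (n :: s)) (fun s => gB _).
have [w1 w2 _] := WP (fun n => (tB n).1).
split=> [|i j] /=; first by rewrite le_max w1 orbT.
case: ifP => _; first by rewrite le_max w2 orbT.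
rewrite le_max; apply/orP; left.
by have [] := ulimP UU (fun n => (tB n).2 i j).
Qed.

(** In [q], the functional is an iterated weak-* limit and the scalars are limits of values of
    [coef]. *)
Definition pairing k (p : X * (nat -> nat -> R)) (q : dual_space X * (nat -> nat -> R)) : R :=
  q.1 p.1 + \sum_(i < k) \sum_(j < d) q.2 i j * p.2 i j.

(** Fixing the first entry [m] of [s] gives [q m] by induction; then everything passes to the limit
    in [m], and [coef (q m).1] supplies the new row. Since [q] depends on [h] alone, it serves
    several [g] at once. *)
Lemma iter_lim_pairing k C (h : seq nat -> dual_space X) :
  (forall s, `|h s| <= C) ->
  exists q : dual_space X * (nat -> nat -> R),
  [/\ `|q.1| <= C, forall i j, `|q.2 i j| <= K * C &
  forall (g : seq nat -> X) B, (forall s, `|g s| <= B) ->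
  forall eps, 0 < eps ->
    iter_near U k (fun s t => `|pairing k (iter_lim k g) q - h s (g t)| < eps)].
Proof.
elim: k h => [|k IH] h hC; have C0 : 0 <= C := le_trans (normr_ge0 _) (hC [::]).
  exists (h [::], fun _ _ => 0); split=> //=.
    by move=> _ _; rewrite normr0 mulr_ge0.
  by move=> g B gB eps e0; rewrite /pairing big_ord0 addr0 subrr normr0.
have /choice[q qP] m := IH (fun s => h (m :: s)) (fun s => hC _).
have q1C m : `|(q m).1| <= C by case: (qP m).
have q2C m i j : `|(q m).2 i j| <= K * C by case: (qP m).
have [F FC FE] := dual_weak_star_limit UU q1C.
have coefC m j : `|coef (q m).1 j| <= K * C.
  by rewrite (le_trans (coef_le _ _))// ler_wpM2l.
exists (F, fun i j => if i == k then ulim U (fun m => coef (q m).1 j)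
                      else ulim U (fun m => (q m).2 i j)); split=> //.
  move=> i j /=; case: ifP => _.
    by have [] := ulimP UU (fun m => coefC m j).
  by have [] := ulimP UU (fun m => q2C m i j).
move=> g B gB eps e0.
have [B' tB'] := iter_lim_bounded k B.
pose t n := iter_lim k (fun s => g (n :: s)).
have tB n : `|(t n).1| <= B' /\ forall i j, `|(t n).2 i j| <= B'.
  by apply: tB' => s; exact: gB.
have [_ _ wP] := WP (fun n => (tB n).1).
set p := iter_lim k.+1 g.
have pW (h' : dual_space X) :
    h' (t n).1 @[n --> U] --> h' p.1 + \sum_(j < d) coef h' j * p.2 k j.
  by rewrite /p /= eqxx; exact: wP.
have pk i j : i != k -> (t n).2 i j @[n --> U] --> p.2 i j.
  by move=> /negbTE ik; rewrite /p /= ik; have [] := ulimP UU (fun n => (tB n).2 i j).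
clearbody p.
(* The limit in [n] with [m] fixed: the functional [(q m).1] does not move, so [W] applies to it. *)
pose P m := (q m).1 p.1 + (\sum_(i < k) \sum_(j < d) (q m).2 i j * p.2 i j +
  \sum_(j < d) coef (q m).1 j * p.2 k j).
have inner m : pairing k (t n) (q m) @[n --> U] --> P m.
  have -> : P m = (q m).1 p.1 + \sum_(j < d) coef (q m).1 j * p.2 k j +
      \sum_(i < k) \sum_(j < d) (q m).2 i j * p.2 i j.
    by rewrite /P [X in _ + X]addrC addrA.
  apply: cvgD.
    exact: pW.
  apply: cvg_sumr => i _; apply: cvg_sumr => j _; apply: cvgM; first exact: cvg_cst.
  by apply: pk; rewrite neq_ltn ltn_ord.
have outer : P m @[m --> U] --> pairing k.+1 p
    (F, fun i j => if i == k then ulim U (fun m => coef (q m).1 j)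
                   else ulim U (fun m => (q m).2 i j)).
  rewrite /pairing big_ord_recr/= eqxx.
  apply: cvgD; first exact: FE.
  apply: cvgD; apply: cvg_sumr => i _.
    apply: cvg_sumr => j _; apply: cvgM; last exact: cvg_cst.
    have /negbTE -> : (i : nat) != k by rewrite neq_ltn ltn_ord.
    by have [] := ulimP UU (fun m => q2C m i j).
  apply: cvgM; last exact: cvg_cst.
  by have [] := ulimP UU (fun m => coefC m i).
(* One third each for the limit in [m], the limit in [n] and the induction hypothesis. *)
have e3 : 0 < eps / 3 by rewrite divr_gt0.
move/cvgrPdist_lt : outer => /(_ _ e3); apply: filterS => m Pm.
move: (inner m) => /cvgrPdist_lt/(_ _ e3); apply: filterS => n tn.
have [_ _ /(_ (fun s => g (n :: s)) B (fun s => gB _) _ e3)] := qP m.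
apply: iter_nearS => s s' /= hs.
have -> : eps = eps / 3 + (eps / 3 + eps / 3) by field.
apply: le_lt_trans (ler_distD (P m) _ _) _; apply: ltrD => //.
by apply: le_lt_trans (ler_distD (pairing k (t n) (q m)) _ _) _; exact: ltrD.
Qed.

(* Each [h s] norms [g i s - g i' s], and [h s] evaluated at [g i t - g i' t]
   with [s], [t] interlaced is close to a pairing that depends only on the
   iterated limits of [g i] and [g i'], which agree up to a small error. *)
Lemma interlaced_differences_bounded (I : Type) (g : I -> seq nat -> X) (B : R) k :
  (forall f : I -> nat, exists i i', i <> i' /\ f i = f i') ->
  (forall eps : R, 0 < eps -> exists c : X -> nat, forall x y, c x = c y -> `|x - y| <= eps) ->
  \oo `<=` U ->
  (forall i s, `|g i s| <= B) ->
  exists i i', i <> i' /\ forall l, exists s t, [/\ size s = k, interlaced l s t &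
    `|g i s - g i' s| <= `|g i s - g i t| + `|g i' s - g i' t| + 1].
Proof.
move=> uncI sepX oU gB.
(* A pairing with [|q.1| <= 1] and scalars of [q] at most [K] changes by at most [D * eps = 1 / 3]
   when each component of the point moves by at most [eps]. *)
pose D := 1 + K * (k * d)%:R.
have D0 : 0 < D by rewrite ltr_wpDr// mulr_ge0.
pose eps := 3^-1 / D.
have e0 : 0 < eps by rewrite divr_gt0.
have [c cP] := sepX _ e0.
(* Equal codes put the [X]-components within [eps] and the scalars in the same cells of width
   [eps]. *)
pose code i := let T := iter_lim k (g i) in
  pickle (c T.1, [seq [seq Num.floor (T.2 i j / eps) | j <- iota 0 d] | i <- iota 0 k]).
have [i [i' [ii' codeE]]] := uncI code.
exists i, i'; split=> // l.
have /(pcan_inj pickleK)[cE flE] := codeE.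
have flE' (a b : nat) : (a < k)%N -> (b < d)%N ->
    `|(iter_lim k (g i)).2 a b - (iter_lim k (g i')).2 a b| <= eps.
  move=> ak bd; have := congr1 (fun s => nth 0 (nth [::] s a) b) flE.
  rewrite !(nth_map 0%N) ?size_map ?size_iota// !nth_iota// !add0n => fE.
  set x := _.2 a b; set y := _.2 a b.
  have hx : `|x / eps - y / eps| <= 1.
    have := ge_floor (x / eps); have := floorD1_gt (x / eps).
    have := ge_floor (y / eps); have := floorD1_gt (y / eps).
    rewrite /x /y fE !intrD => *; rewrite ler_norml; apply/andP; split; lra.
  by rewrite -mulrBl normrM normfV (gtr0_norm e0) ler_pdivrMr// mul1r in hx.
have /choice[h hP] s : exists h : dual_space X,
    `|h| <= 1 /\ `|g i s - g i' s| <= h (g i s - g i' s).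
  by have [h h1 hn] := dual_norming (g i s - g i' s); exists h.
have [q [q1 q2 qP]] := iter_lim_pairing k (fun s => (hP s).1).
have e3 : 0 < (3^-1 : R) by rewrite invr_gt0.
have := iter_nearI UU (qP _ _ (gB i) _ e3) (qP _ _ (gB i') _ e3).
move=> /(iter_near_interlaced UU l oU)[s [t [sk st [p1 p2]]]].
exists s, t; split=> //.
have p12 : `|pairing k (iter_lim k (g i)) q - pairing k (iter_lim k (g i')) q| <= 3^-1.
  rewrite /pairing opprD addrACA -dualB -sumrB.
  have -> : 3^-1 = eps + K * (k * d)%:R * eps.
    by rewrite -[X in X + _]mul1r -mulrDl /eps mulrC divfK// gt_eqF.
  rewrite (le_trans (ler_normD _ _))//; apply: lerD.
    by rewrite (le_trans (dual_bound _ _))// -[leRHS]mul1r ler_pM// cP.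
  rewrite (le_trans (ler_norm_sum _ _ _))//.
  apply: (@le_trans _ _ (\sum_(a < k) \sum_(b < d) K * eps)).
    apply: ler_sum => a _; rewrite -sumrB (le_trans (ler_norm_sum _ _ _))//.
    apply: ler_sum => b _; rewrite -mulrBr normrM ler_pM//; last exact: flE'.
    by have := q2 a b; rewrite mulr1.
  by rewrite !sumr_const !card_ord -mulrnA mulnC -[leLHS]mulr_natr mulrAC.
have h1 x : h s x <= `|x|.
  rewrite (le_trans (ler_norm _))// (le_trans (dual_bound _ _))//.
  by rewrite -[leRHS]mul1r ler_wpM2r// (hP s).1.
apply: (le_trans (hP s).2).
(* Split [g i s - g i' s] through [g i t - g i' t]. On the middle term [h s] is at most [1]: one
   third from the pairings and one third from each approximation. *)
have := h1 (g i s - g i t); have := h1 (g i' t - g i' s).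
rewrite !dualB (distrC (g i' t)).
by move: p1 p2 p12; rewrite !ltr_norml ler_norml => /andP[? ?] /andP[? ?] /andP[? ?]; lra.
Qed.

End iterated_limits.

(** * Uncountably many index sets against the separability of [X] *)

(** Cantor's diagonal argument. *)
Lemma nat_valued_not_injective (f : (nat -> bool) -> nat) : exists A B, A <> B /\ f A = f B.
Proof.
apply: contrapT => inj_f.
pose A n := `[< exists B, f B = n /\ ~~ B n >].
have [Af|nA] := boolP (A (f A)).
  have /asboolP[B [fB nB]] := Af.
  have BA : B = A by apply: contrapT => BA; apply: inj_f; exists B, A.
  by rewrite BA Af in nB.
by move: (nA) => /asboolPn; apply; exists A.
Qed.

Section basis_separable.
Variables (R : realType) (X : completeNormedModType R).
Variables (e : nat -> X) (estar : nat -> dual_space X).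
Hypothesis basis_e : schauder_basis e.
Hypothesis estarE : biorthogonal e estar.

(** Separability as a countable partition into pieces of diameter at most [eps]: the code records a
    length [N x] at which the projection is [eps / 3]-close to [x], and the first [N x] coordinates
    rounded to mesh [(M (N x))^-1]. *)
Lemma countable_code (eps : R) : 0 < eps ->
  exists c : X -> nat, forall x y, c x = c y -> `|x - y| <= eps.
Proof.
move=> e0; have e3 : 0 < eps / 3 by rewrite divr_gt0.
have /choice[N NP] x : exists n, `|x - basis_proj e estar n x| < eps / 3.
  have /cvgrPdist_lt/(_ _ e3) := @basis_proj_cvg _ _ _ _ basis_e estarE x.
  by move=> /filter_ex[n]; exists n.
pose S n := \sum_(0 <= i < n) `|e i| + 1.
have S0 n : 0 < S n by rewrite ltr_wpDl// sumr_ge0.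
pose M n := S n / (eps / 3).
have M0 n : 0 < M n by rewrite divr_gt0.
exists (fun x => pickle (N x, [seq Num.floor (estar i x * M (N x)) | i <- iota 0 (N x)])).
move=> x y /(pcan_inj pickleK)[NE]; move: (NP x) (NP y); rewrite -NE.
set n := N x => xn yn flE.
have coordE i : (i < n)%N -> `|estar i x - estar i y| <= (M n)^-1.
  move=> i_n; have := congr1 (fun s => nth 0 s i) flE.
  rewrite !(nth_map 0%N) ?size_iota// !nth_iota// add0n => fE.
  rewrite -(ler_pM2r (M0 n)) mulVf ?gt_eqF// -(gtr0_norm (M0 n)) -normrM mulrBl.
  have := ge_floor (estar i x * M n); have := floorD1_gt (estar i x * M n).
  have := ge_floor (estar i y * M n); have := floorD1_gt (estar i y * M n).
  by rewrite fE !intrD => *; rewrite ler_norml; apply/andP; split; lra.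
have proj_le : `|basis_proj e estar n x - basis_proj e estar n y| <= eps / 3.
  rewrite /basis_proj /series/= -sumrB (le_trans (ler_norm_sum _ _ _))//.
  apply: (@le_trans _ _ ((M n)^-1 * \sum_(0 <= i < n) `|e i|)).
    rewrite mulr_sumr !big_mkord; apply: ler_sum => i _.
    by rewrite -scalerBl normrZ ler_wpM2r// coordE.
  rewrite ler_pdivrMl// /M -mulrA mulVf ?gt_eqF// mulr1.
  by rewrite lerDl.
have -> : x - y = (x - basis_proj e estar n x) +
    (basis_proj e estar n x - basis_proj e estar n y) - (y - basis_proj e estar n y).
  by rewrite addrA subrK opprB addrA subrK.
rewrite (le_trans (ler_normB _ _))// (le_trans (lerD (ler_normD _ _) (lexx _)))//.
lra.
Qed.

End basis_separable.

(** * The functions [f_A] with values in [c0] *)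

Section interlacing_in_c0.
Variable R : realType.

Lemma c0_norm_ge (u : c0 R) n : `|u n| <= `|u|.
Proof. by apply: (@sup_abs_ge R nat setT u n) => //; exact: c0_ubound. Qed.

Lemma c0_norm_le (u : c0 R) (M : R) : (forall n, `|u n| <= M) -> `|u| <= M.
Proof. by move=> uM; apply: (@sup_abs_le R nat setT u) => //; exists 0%N. Qed.

Definition tail_count (A : nat -> bool) (s : seq nat) (k : nat) : R :=
  (A k)%:R * (count (leq k) s)%:R.

Lemma tail_count_null A s : tail_count A s \in @null_seq R.
Proof.
apply/asboolP; apply: cvg_near_cst; exists (\max_(i <- s) i).+1 => // k /= sk.
rewrite /tail_count (_ : count _ s = 0%N) ?mulr0//; apply/eqP.
rewrite -leqn0 leqNgt -has_count; apply/hasPn => n ns; rewrite -ltnNge.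
by apply: leq_trans sk; rewrite ltnS; exact: (leq_bigmax_seq n).
Qed.

Definition c0_tail_count A s : c0 R := C0 (tail_count_null A s).

Lemma interlaced_size l s t : interlaced l s t -> size s = size t.
Proof.
elim: s l t => [|m s IH] l [|n t]//= /and3P[_ _ /IH ->]//.
Qed.

(** At most one index has its entry of [s] below [k] and its entry of [t] not below [k]; all later
    entries of both count. The second clause, used at the next lower bound, provides this in the
    induction. *)
Lemma interlaced_count l s t k : interlaced l s t ->
  (count (leq k) s <= count (leq k) t <= (count (leq k) s).+1)%N /\
  ((k <= l)%N -> count (leq k) s = size s /\ count (leq k) t = size t).
Proof.
elim: s l t => [|m s IH] l [|n t]//=.
move=> /and3P[lm mn /[dup] /interlaced_size st /IH[/andP[IH1 IH2] IH3]].
split=> [|kl]; last first.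
  have km := leq_trans kl lm; have kn := leq_trans km mn.
  by have [-> ->] := IH3 kn; rewrite km kn.
have [kn|nk] := leqP k n.
  by have [-> ->] := IH3 kn; rewrite st; case: (k <= m)%N;
    rewrite /= ?leqnn ?leqnSn ?andbT ?add0n ?add1n ?leqnn.
by rewrite [(k <= m)%N]leqNgt (leq_ltn_trans mn nk)/= !add0n IH1.
Qed.

Lemma c0_tail_count_norm A s : `|c0_tail_count A s| <= (size s)%:R.
Proof.
apply: c0_norm_le => k; rewrite /= /tail_count normrM !normr_nat -natrM ler_nat.
by case: (A k); rewrite ?mul1n ?mul0n// count_size.
Qed.

Lemma c0_tail_count_interlaced A l s t : interlaced l s t ->
  `|c0_tail_count A s - c0_tail_count A t| <= 1.
Proof.
move=> st; apply: c0_norm_le => k.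
rewrite [X in `|X|](_ : _ = tail_count A s k - tail_count A t k)//.
rewrite /tail_count -mulrBr normrM normr_nat distrC.
have [/andP[st1 st2] _] := interlaced_count k st.
rewrite -natrB// normr_nat -natrM -[leRHS]/(1%:R) ler_nat.
by case: (A k); rewrite ?mul1n ?mul0n// leq_subLR addn1.
Qed.

(** At coordinate [k] every entry of [s] counts, so one of the two sequences equals [size s] there
    and the other vanishes. *)
Lemma c0_tail_count_far A B k l s t : A k != B k -> (k <= l)%N ->
  interlaced l s t -> (size s)%:R <= `|c0_tail_count A s - c0_tail_count B s|.
Proof.
move=> AB kl st; apply: le_trans (c0_norm_ge _ k).
rewrite [X in `|X|](_ : _ = tail_count A s k - tail_count B s k)//.
rewrite /tail_count (_ : count _ s = size s); last first.
  by have [_ /(_ kl)[]] := interlaced_count k st.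
by move: AB; case: (A k); case: (B k) => // _;
  rewrite mul1r mul0r ?subr0 ?sub0r ?normrN normr_nat.
Qed.

End interlacing_in_c0.

Theorem theorem22 (R : realType) (X : completeNormedModType R)
    (e : nat -> X) (estar : nat -> dual_space X) (Z : set (dual_space X)) :
  schauder_basis e ->
  boundedly_complete e ->
  biorthogonal e estar ->
  fin_dim_subspace Z ->
  direct_sum (closed_span (range estar)) Z ->
  ~ coarsely_embeds (norm_metric (c0 R)) (norm_metric X).
Proof.
move=> basis_e bc_e estarE finZ sumZ [phi [rho [omega [pos mono rho_oo phiP]]]].
have [U [UU oU]] := ultraFilterLemma eventually_filter.
have [d [K [coef codimX]]] := finite_codim_limits_exists basis_e bc_e estarE finZ sumZ UU.
have [W WP] := bidual_limit_exists codimX.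
(* This tuple length makes the lower bound [rho k%:R] exceed what interlacing permits. *)
have [k rho_k] : exists k : nat, 2 * omega 1 + 1 < rho k%:R.
  have /cvgryPgt/(_ (2 * omega 1 + 1)) := rho_oo.
  move=> /(filterI (nbhs_pinfty_ge (num_real (0 : R))))/filter_ex[t [/= t0 rt]].
  exists (Num.trunc t).+1; apply: (lt_le_trans rt).
  by have [] := mono _ _ t0 (ltW (truncnS_gt t)).
(* Truncation makes the family bounded over all finite sequences and changes nothing on tuples of
   length [k]. *)
pose f (A : nat -> bool) s : c0 R := c0_tail_count R A (take k s).
pose g A s : X := phi (f A s).
have phi_dist (u v : c0 R) : rho `|u - v| <= `|(phi u : X) - phi v| <= omega `|u - v|.
  by have := phiP u v; rewrite !norm_metricE.
have gB A s : `|g A s| <= omega k%:R + `|phi 0 : X|.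
  rewrite -[g A s](subrK (phi 0 : X)) (le_trans (ler_normD _ _))// lerD2r.
  have /andP[_ /le_trans] := phi_dist (f A s) 0; apply; rewrite subr0.
  have [] // := mono `|f A s| k%:R (normr_ge0 _) _.
  rewrite (le_trans (c0_tail_count_norm _ _ _))// ler_nat.
  by rewrite size_take; case: ltnP.
have [A [B [AB gAB]]] := interlaced_differences_bounded UU codimX WP k nat_valued_not_injective
  (countable_code basis_e estarE) oU gB.
have [n ABn] : exists n, A n != B n.
  apply: contrapT => h; apply: AB; apply/funext => n; apply/eqP.
  by apply/negPn/negP => ABn; apply: h; exists n.
(* Taking the lower bound [n] puts all entries at or beyond a coordinate where [A] and [B]
   differ. *)
have [s [t [sk st]]] := gAB n.
have tk : size t = k by rewrite -(interlaced_size st).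
have gst C : `|g C s - g C t| <= omega 1.
  have /andP[_ /le_trans] := phi_dist (f C s) (f C t); apply.
  have [] // := mono `|f C s - f C t| 1 (normr_ge0 _) _.
  by rewrite /f !take_oversize ?sk ?tk//; exact: c0_tail_count_interlaced st.
have gABs : rho k%:R <= `|g A s - g B s|.
  have /andP[+ _] := phi_dist (f A s) (f B s); apply: le_trans.
  have [] // := mono k%:R `|f A s - f B s| (ler0n _ _) _.
  rewrite /f !take_oversize ?sk// -[in leLHS]sk.
  exact: c0_tail_count_far ABn (leqnn n) st.
have := gst A; have := gst B; move: rho_k gABs; lra.
Qed.
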